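(* Let $q$ be a power of $2$, let $a,b,c\in\mathbb F_{q^2}$ and $d\in\mathbb F_{q^2}\setminus\mathbb F_q$. Suppose that $a^2+ab+c\in\{0,\operatorname{Tr}(a+b)^2\}$ and $a+b+d=0$. Then \[\frac{x^{q+1}+x^2+ax^q+bx+c}{x^q+x+d}\] is a permutation rational function of $\mathbb F_{q^2}$.
   Context: $\operatorname{Tr}(x)=x^q+x$ for $x\in\mathbb F_{q^2}$. A rational function $f$ over a finite field $\mathbb F_Q$ is written uniquely as $f=e\,\frac{g}{h}$ with $g,h$ relatively prime monic polynomials over $\mathbb F_Q$ and $e\in\mathbb F_Q^*$. It defines a map on $\mathbb F_Q\cup\{\infty\}$: for $s\in\mathbb F_Q$, $f(s)=e\,g(s)/h(s)$ if $h(s)\neq0$ and $f(s)=\infty$ if $h(s)=0$; moreover $f(\infty)=\infty$ if $\deg g>\deg h$, $f(\infty)=e$ if $\deg g=\deg h$, and $f(\infty)=0$ if $\deg g<\deg h$. If this map is a permutation of $\mathbb F_Q\cup\{\infty\}$, then $f$ is called a permutation rational function of $\mathbb F_Q$. Here $Q=q^2$. (Since $d\notin\mathbb F_q$, the denominator $x^q+x+d$ has no zero in $\mathbb F_{q^2}$.) *)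

(* Defs.v *)
From mathcomp Require Import all_boot all_algebra.

Set Implicit Arguments.
Unset Strict Implicit.
Unset Printing Implicit Defensive.

Import GRing.Theory.
Local Open Scope ring_scope.

Notation "x %:F" := (@FracField.tofrac _ x) : ring_scope.

Section RationalFunctions.
Variable F : fieldType.
Implicit Types (f : {fraction {poly F}}) (g h : {poly F}) (e : F).

Definition lowest_terms f e g h : Prop :=
  [/\ e != 0, g \is monic, h \is monic, coprimep g h &
      f = (e *: g)%:F / h%:F].

(* The projective line over F is [option F], with [None] standing for
   infinity. *)
Definition ratfun_map e g h (s : option F) : option F :=
  match s with
  | Some x => if h.[x] == 0 then None else Some (e * g.[x] / h.[x])
  | None => if (size h < size g)%N then None
            else if size g == size h then Some e else Some 0
  end.

(* A nonzero [f] has exactly one triple in lowest terms (see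
   [lowest_terms_exists] and [lowest_terms_unique]), and 0 has none. *)
Definition permutation_ratfun f : Prop :=
  exists e g h, lowest_terms f e g h /\ bijective (ratfun_map e g h).

Lemma lowest_terms_unique f e g h e' g' h' :
  lowest_terms f e g h -> lowest_terms f e' g' h' ->
  [/\ e = e', g = g' & h = h'].
Proof.
case=> e0 mg mh cgh -> [e0' mg' mh' cgh'] /eqP.
rewrite eqr_div ?tofrac_eq0 ?monic_neq0 // -!tofracM tofrac_eq => /eqP eq1.
have dv : forall (u v : F) (p r p' r' : {poly F}), v != 0 ->
    coprimep p' r' -> (u *: p) * r' = (v *: p') * r -> r' %| r.
  move=> u v p r p' r' v0 cpr eq2.
  have cpr2: coprimep r' p' by rewrite coprimep_sym.
  rewrite -(Gauss_dvdpr r cpr2).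
  by rewrite -(dvdpZr _ _ v0) scalerAl -eq2 dvdp_mull.
have eqh : h = h'.
  apply/eqP; rewrite -eqp_monic //; apply/andP; split.
    by apply: (dv e' e g' h' g h) => //; rewrite -eq1.
  by apply: (dv e e' g h g' h').
rewrite -eqh in eq1; have eq2 := mulIf (monic_neq0 mh) eq1.
have ee : e = e'.
  have := congr1 lead_coef eq2.
  by rewrite !lead_coefZ (monicP mg) (monicP mg') !mulr1.
by split=> //; rewrite -ee in eq2; exact: (scalerI e0 eq2).
Qed.

Lemma lowest_terms_exists (p r : {poly F}) :
  p != 0 -> r != 0 -> exists e g h, lowest_terms (p%:F / r%:F) e g h.
Proof.
move=> p0 r0; set k := gcdp p r.
have k0 : k != 0 by rewrite gcdp_eq0 negb_and p0.
have pE : p = p %/ k * k by rewrite divpK ?dvdp_gcdl.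
have rE : r = r %/ k * k by rewrite divpK ?dvdp_gcdr.
have p'0 : p %/ k != 0 by apply: contra_neq p0 => z; rewrite pE z mul0r.
have r'0 : r %/ k != 0 by apply: contra_neq r0 => z; rewrite rE z mul0r.
set u := lead_coef (p %/ k); set v := lead_coef (r %/ k).
have u0 : u != 0 by rewrite lead_coef_eq0.
have v0 : v != 0 by rewrite lead_coef_eq0.
exists (u / v), (u^-1 *: (p %/ k)), (v^-1 *: (r %/ k)); split.
- by rewrite mulf_neq0 ?invr_eq0.
- by rewrite monicE lead_coefZ mulVf.
- by rewrite monicE lead_coefZ mulVf.
- rewrite coprimepZl ?invr_eq0 // coprimepZr ?invr_eq0 //.
  by rewrite coprimep_div_gcd // p0.
apply/eqP; rewrite eqr_div ?tofrac_eq0 ?scaler_eq0 ?invr_eq0 ?negb_or ?v0 //.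
have cross : p * (r %/ k) = p %/ k * r.
  by rewrite [X in X * _]pE [X in _ = _ * X]rE -mulrA [k * _]mulrC.
rewrite -!tofracM tofrac_eq scalerA mulrAC mulfV // mul1r.
by rewrite -scalerAr -scalerAl cross.
Qed.

End RationalFunctions.

Definition Tr (F : fieldType) (q : nat) (x : F) : F := x ^+ q + x.

(* Main.v *)
Require Import Defs.
From mathcomp Require Import all_boot all_algebra.
From HB Require Import structures.
From mathcomp Require Import finfield ring.
Local Open Scope ring_scope.

Import GRing.Theory.

(** Write s for the automorphism x |-> x ^+ q, an involution of the field F
    with fixed field Fq, and h = 'X^q + 'X + d.  As a + b = d, division by h
    turns the fraction into x + a + k / h with k = a ^+ 2 + a * b + c
    ([numerator_division]).  Since d is not fixed by s while s x + x is, h has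
    no root in F.  If k = 0 the fraction is a translation.  Otherwise
    numerator and denominator are coprime, infinity is the only point sent to
    infinity, and it remains to see that x |-> x + k / h(x) is injective on F
    ([permutation_ratfun_add_inv]); here k = (s d + d) ^+ 2.

    This injectivity only uses an involution s of a field of characteristic 2
    and an element d moved by it.  Dividing everything by the fixed element
    s d + d reduces to the case k = 1, s d = d + 1.  Suppose that x and y have
    the same image, and put A = s x + x + d, B = s y + y + d, so that
    s A = A + 1 and s B = B + 1.  The equality of the images, x + 1/A = y + 1/B,
    added to its conjugate, gives A + 1/(A (A + 1)) = B + 1/(B (B + 1)).  If
    A = B then x = y.  If not, this becomes an equation of degree 2 in
    w = A + B with coefficients in the fixed element u = A (A + 1)
    ([collision_relation]); its Artin-Schreier normal form is
    beta ^+ 2 + beta = u with beta = u w / (u + 1) ([artin_schreier_root]).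
    Hence beta is A or A + 1.  But beta is fixed by s, whereas A and A + 1
    are exchanged. *)

(** * Characteristic 2 *)

Lemma two_eq0 (R : nzRingType) (char2 : 2%N \in [pchar R]) : 2 = 0 :> R.
Proof. exact: pcharf0 char2. Qed.

Lemma add_eq0_char2 (R : nzRingType) (char2 : 2%N \in [pchar R]) (x y : R) :
  (x + y == 0) = (x == y).
Proof. by rewrite addr_eq0 oppr_pchar2. Qed.

Lemma addS_char2 (R : nzRingType) (char2 : 2%N \in [pchar R]) (x : R) :
  x + 1 + 1 = x.
Proof. by rewrite -addrA -[1 + 1]/2 two_eq0 // addr0. Qed.

(** * Injectivity of x + k / (s x + x + d) *)

(** The relation is the quadratic equation u w^2 + (u + 1) w + (u + 1)^2 = 0
    in w; the substitution w = beta (u + 1) / u divides out its leading and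
    linear coefficients. *)
Lemma artin_schreier_root (K : fieldType) (char2 : 2%N \in [pchar K]) (u w : K) :
    u + 1 != 0 -> u ^+ 2 + u * w ^+ 2 + u * w = w + 1 ->
  (u * w / (u + 1)) ^+ 2 + u * w / (u + 1) = u.
Proof.
move=> u1 rel; apply/eqP; rewrite -subr_eq0.
have -> : (u * w / (u + 1)) ^+ 2 + u * w / (u + 1) - u
    = u * ((u ^+ 2 + u * w ^+ 2 + u * w - (w + 1)) + 2 * (w - u ^+ 2 - u))
      / (u + 1) ^+ 2 by field.
by rewrite rel subrr two_eq0 // mul0r addr0 mulr0 mul0r.
Qed.

Lemma inv_sum_char2 (K : fieldType) (char2 : 2%N \in [pchar K]) (z : K) :
  z != 0 -> z + 1 != 0 -> (z + 1)^-1 + z^-1 = (z * (z + 1))^-1.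
Proof.
move=> z0 z1.
have -> : (z + 1)^-1 + z^-1 = (2 * z + 1) / (z * (z + 1)).
  by field; rewrite z0 z1.
by rewrite two_eq0 // mul0r add0r mul1r.
Qed.

(** With v = B (B + 1), the hypothesis divided by A - B reads u v = w + 1,
    and v = u + w^2 + w eliminates v. *)
Lemma collision_relation (K : fieldType) (char2 : 2%N \in [pchar K]) (A B : K) :
    A != 0 -> A + 1 != 0 -> B != 0 -> B + 1 != 0 -> A != B ->
    A + (A * (A + 1))^-1 = B + (B * (B + 1))^-1 ->
  let u := A * (A + 1) in let w := A + B in
  u ^+ 2 + u * w ^+ 2 + u * w = w + 1.
Proof.
move=> A0 A1 B0 B1 AB /eqP; rewrite -subr_eq0.
have -> : A + (A * (A + 1))^-1 - (B + (B * (B + 1))^-1)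
  = (A - B) * (A * (A + 1) * (B * (B + 1)) - (A + B + 1))
     / (A * (A + 1) * (B * (B + 1))).
  by field; rewrite A0 A1 B0 B1.
rewrite !mulf_eq0 invr_eq0 !mulf_eq0 (negbTE A0) (negbTE A1) (negbTE B0) (negbTE B1).
rewrite !orbF !subr_eq0 (negbTE AB) /= => /eqP <-.
transitivity (A * (A + 1) * (B * (B + 1))
              + 2 * (A * (A + 1) * (A ^+ 2 + A + A * B))); first by ring.
by rewrite two_eq0 // mul0r addr0.
Qed.

(** Two distinct points with the same image would produce a fixed root of
    the polynomial z^2 + z + A (A + 1), whose roots A and A + 1 are exchanged
    by sigma. *)
Lemma add_inv_conj_injective_normalized (K : fieldType) (char2 : 2%N \in [pchar K])
    (sigma : {rmorphism K -> K}) (sigmaK : involutive sigma) (delta : K) :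
  sigma delta = delta + 1 ->
  injective (fun x => x + (sigma x + x + delta)^-1).
Proof.
move=> sdelta x y /=.
have s_shift z : sigma (sigma z + z + delta) = sigma z + z + delta + 1.
  by rewrite !rmorphD /= sigmaK sdelta (addrC z) !addrA.
move: (s_shift x) (s_shift y).
have AE z : sigma z + z = sigma z + z + delta + delta.
  by rewrite -addrA -mulr2n -mulr_natl two_eq0 // mul0r addr0.
have unshift z : sigma z = z + 1 -> (z != 0) * (z + 1 != 0).
  move=> sz; suff z0 : z != 0 by rewrite -sz fmorph_eq0 z0.
  by apply: contra_eq_neq sz => ->; rewrite rmorph0 add0r eq_sym oner_neq0.
(* From here on only the following matters about x: its denominator A,
   the value A + 1 of sigma A, and the trace sigma x + x = A + delta. *)
move: (AE x) (AE y).
move: (sigma x + x + delta) (sigma y + y + delta) => A B xA yB sA sB eq_xy.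
have [A0 A1] := unshift _ sA; have [B0 B1] := unshift _ sB.
have [AB | neqAB] := eqVneq A B.
  by move: eq_xy; rewrite AB => /addIr.
(* The equation of the images, added to its conjugate. *)
have tr : A + (A * (A + 1))^-1 = B + (B * (B + 1))^-1.
  have := congr2 +%R (congr1 sigma eq_xy) eq_xy.
  rewrite !rmorphD !fmorphV /= sA sB addrACA [RHS]addrACA !inv_sum_char2 //.
  by rewrite xA yB !(addrAC _ delta) => /addIr.
have rel := collision_relation _ char2 _ _ A0 A1 B0 B1 neqAB tr.
set u := A * (A + 1) in rel; set w := A + B in rel.
have s_u : sigma u = u.
  by rewrite /u rmorphM rmorphD rmorph1 /= sA addS_char2 // mulrC.
have s_w : sigma w = w.
  by rewrite /w rmorphD /= sA sB addrACA -[1 + 1]/2 two_eq0 // addr0.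
(* For u = 1 the relation has no linear term, and forces w = 0. *)
have [u1 | u_neq1] := eqVneq (u + 1) 0.
  have u1' : u = 1 by apply/eqP; rewrite -add_eq0_char2 //; apply/eqP.
  move: rel; rewrite /= -/u -/w u1' expr1n !mul1r => /eqP.
  rewrite addrAC [w + 1]addrC -[eqbRHS]addr0 (inj_eq (addrI _)) expf_eq0 /=.
  by rewrite /w add_eq0_char2 // (negbTE neqAB).
have := artin_schreier_root _ char2 _ _ u_neq1 rel.
set beta := u * w / (u + 1) => beta_root.
have s_beta : sigma beta = beta.
  by rewrite /beta rmorphM fmorphV rmorphD rmorphM rmorph1 /= s_u s_w.
have not_root z : sigma z = z + 1 -> beta != z.
  apply: contra_eq_neq => <-.
  by rewrite s_beta -subr_eq0 opprD addrA subrr sub0r oppr_eq0 oner_neq0.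
have sA1 : sigma (A + 1) = A + 1 + 1 by rewrite rmorphD rmorph1 /= sA.
have : (beta + A) * (beta + (A + 1)) == 0.
  have -> : (beta + A) * (beta + (A + 1))
      = beta ^+ 2 + beta + u + 2 * (beta * A) by rewrite /u; ring.
  by rewrite beta_root two_eq0 // mul0r addr0 add_eq0_char2.
by rewrite mulf_eq0 !add_eq0_char2 // (negbTE (not_root _ sA))
  (negbTE (not_root _ sA1)).
Qed.

(** Scaling by the fixed element sigma d + d reduces to sigma d = d + 1. *)
Lemma add_inv_conj_injective (K : fieldType) (char2 : 2%N \in [pchar K])
    (sigma : {rmorphism K -> K}) (sigmaK : involutive sigma) (d : K) :
    sigma d != d ->
  injective (fun x => x + (sigma d + d) ^+ 2 / (sigma x + x + d)).
Proof.
move=> d_moved; set t := sigma d + d.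
have t0 : t != 0 by rewrite add_eq0_char2.
have st : sigma t = t by rewrite /t rmorphD /= sigmaK addrC.
have sdt : sigma (d / t) = d / t + 1.
  rewrite rmorphM fmorphV /= st -[X in _ + X](divff t0) -mulrDl; congr (_ / _).
  by rewrite /t addrCA -mulr2n -mulr_natl two_eq0 // mul0r addr0.
move=> x y /= eq_xy; apply: (mulIf (invr_neq0 t0)).
apply: (add_inv_conj_injective_normalized _ char2 _ sigmaK _ sdt) => /=.
have scale z : z / t + (sigma (z / t) + z / t + d / t)^-1
    = (z + t ^+ 2 / (sigma z + z + d)) / t.
  rewrite rmorphM fmorphV /= st -!mulrDl invf_div [RHS]mulrDl; congr (_ + _).
  by rewrite [RHS]mulrAC expr2 mulfK.
by rewrite !scale eq_xy.
Qed.

(** * The automorphism x ^+ q and its fixed field *)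

Section FrobeniusPower.
Variables (R : comNzRingType) (p : nat) (charRp : p \in [pchar R]) (n : nat).

(** The characteristic is an argument because the ring morphism structure
    attached below depends on it. *)
Definition pFrobenius_autn of p \in [pchar R] := fun x : R => x ^+ (p ^ n).

Lemma pFrobenius_autn_is_additive : nmod_morphism (pFrobenius_autn charRp).
Proof.
have p_gt0 := prime_gt0 (pcharf_prime charRp).
split=> [|x y]; first by rewrite /pFrobenius_autn expr0n expn_eq0 eqn0Ngt p_gt0.
by rewrite /pFrobenius_autn exprDn_pchar // pnatX pnatE ?charRp ?(pcharf_prime charRp).
Qed.

HB.instance Definition _ :=
  GRing.isNmodMorphism.Build R R (pFrobenius_autn charRp)
    pFrobenius_autn_is_additive.

Lemma pFrobenius_autn_is_monoid_morphism :
  monoid_morphism (pFrobenius_autn charRp).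
Proof.
by split=> [|x y]; rewrite /pFrobenius_autn ?expr1n ?exprMn.
Qed.

HB.instance Definition _ :=
  GRing.isMonoidMorphism.Build R R (pFrobenius_autn charRp)
    pFrobenius_autn_is_monoid_morphism.
End FrobeniusPower.

(** Multiplication by a nonzero x in S permutes the nonzero elements of S, so
    it leaves their product unchanged. *)
Lemma subfield_expf_card (F : finFieldType) (S : {set F}) (x : F) :
  divring_closed S -> x \in S -> x ^+ #|S| = x.
Proof.
case=> S1 SB Sdiv xS.
have S0 : 0 \in S by rewrite -(subrr 1) SB.
rewrite (cardsD1 0) S0 exprS.
have [-> | x0] := eqVneq x 0; first by rewrite mul0r.
have SV y : y \in S -> y^-1 \in S by move=> yS; rewrite -[_^-1]mul1r Sdiv.
have SM y z : y \in S -> z \in S -> y * z \in S.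
  by move=> yS zS; rewrite -[z]invrK Sdiv // SV.
apply/eqP; rewrite -[eqbRHS]mulr1 (inj_eq (mulfI x0)).
have P0 : \prod_(y in S :\ 0) y != 0.
  by apply/prodf_neq0 => y; rewrite !inE => /andP[].
apply/eqP/(mulIf P0); rewrite mul1r -prodrMl.
rewrite [RHS](reindex_onto ( *%R x) ( *%R x^-1)) /=; last first.
  by move=> y _; rewrite mulVKf.
apply: eq_bigl => y; rewrite !inE mulKf // eqxx andbT mulf_eq0 (negbTE x0) /=.
apply: andb_id2l => y0; apply/idP/idP => [|xyS]; first exact: SM.
by rewrite -(mulKf x0 y) SM ?SV.
Qed.

(** The polynomial 'X^#|S| - 'X vanishes on S, and its degree leaves no room
    for another root. *)
Lemma subfield_fixed (F : finFieldType) (S : {set F}) (x : F) :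
  divring_closed S -> (x \in S) = (x ^+ #|S| == x).
Proof.
move=> closedS; apply/idP/eqP => [|xq]; first exact: subfield_expf_card.
have S_gt1 : (1 < #|S|)%N.
  have [S1 SB _] := closedS; rewrite (cardD1 1) S1 (cardD1 0) !inE.
  by rewrite eq_sym oner_neq0 -(subrr 1) SB.
pose P : {poly F} := 'X^#|S| - 'X.
have sizeP : size P = #|S|.+1.
  by rewrite size_polyDl ?size_polyXn // size_polyN size_polyX.
have rootP y : y ^+ #|S| = y -> root P y.
  by move=> yq; rewrite rootE !hornerE yq subrr.
apply: contraT => xNS.
have := @max_poly_roots _ P (x :: enum S).
rewrite sizeP /= -cardE ltnn; apply.
- by rewrite -size_poly_eq0 sizeP.
- rewrite rootP //=; apply/allP => y; rewrite mem_enum => yS.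
  exact/rootP/subfield_expf_card.
- by rewrite mem_enum xNS enum_uniq.
Qed.

(** * Passing to the projective line *)

(** The degree of the numerator exceeds that of h by one, so infinity is fixed,
    and no other point is sent there. For k = 0 the fraction reduces to
    'X + a; for k != 0 it is already in lowest terms, a common divisor of
    numerator and denominator being a divisor of the constant k. *)
Lemma permutation_ratfun_add_inv (F : finFieldType) (h : {poly F}) (a k : F) :
    h \is monic -> (forall x, h.[x] != 0) ->
    injective (fun x => x + k / h.[x]) ->
  permutation_ratfun ((('X + a%:P) * h + k%:P)%:F / h%:F).
Proof.
move=> mon_h h_neq0 inj_f.
have h0 := monic_neq0 mon_h.
have size_l : size ('X + a%:P) = 2 by rewrite size_XaddC.
have mon_l : 'X + a%:P \is monic by rewrite -[a]opprK polyCN monicXsubC.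
have bij (g h' : {poly F}) : (forall x, h'.[x] != 0) -> size g = (size h').+1 ->
    (forall x, g.[x] / h'.[x] = x + a + k / h.[x]) ->
  bijective (ratfun_map 1 g h').
  move=> h'0 size_g gE; apply: injF_bij; case=> [x|] [y|] //=.
  - rewrite !(negbTE (h'0 _)) !mul1r !gE => -[].
    by rewrite !(addrAC _ a) => /addIr /inj_f ->.
  - by rewrite (negbTE (h'0 _)) size_g ltnSn.
  - by rewrite (negbTE (h'0 _)) size_g ltnSn.
have [k0 | k_neq0] := eqVneq k 0.
  exists 1, ('X + a%:P), 1; split.
    split; rewrite ?oner_neq0 ?monic1 ?coprimep1 //.
    by rewrite k0 addr0 scale1r tofracM mulfK ?tofrac_eq0 // tofrac1 divr1.
  apply: bij => [x||x]; first by rewrite hornerE oner_neq0.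
    by rewrite size_l size_poly1.
  by rewrite k0 mul0r addr0 !hornerE divr1.
have size_lh : size (('X + a%:P) * h) = (size h).+1.
  by rewrite size_monicM // size_l.
have size_k : (size (k%:P : {poly F}) < size (('X + a%:P) * h)%R)%N.
  by rewrite size_lh size_polyC k_neq0 ltnS lt0n size_poly_eq0.
exists 1, (('X + a%:P) * h + k%:P), h; split; first split=> //.
- exact: oner_neq0.
- by rewrite monicE lead_coefDl // -monicE monicMl.
- rewrite coprimep_sym coprimep_addl_mul.
  by rewrite -[k%:P]mulr1 mul_polyC coprimepZr // coprimep1.
- by rewrite scale1r.
apply: bij => // [|x]; first by rewrite size_polyDl.
by rewrite !hornerE mulrDl mulfK.
Qed.

(** Applied with x = 'X and y = 'X^q, this is the division of the numerator by
    the denominator when d = a + b. *)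
Lemma numerator_division (R : comNzRingType) (char2 : 2%N \in [pchar R])
    (x y a b c : R) :
  x * y + x ^+ 2 + a * y + b * x + c
  = (x + a) * (y + x + (a + b)) + (a ^+ 2 + a * b + c).
Proof.
transitivity (x * y + x ^+ 2 + a * y + b * x + c
              + 2 * (a * x + a ^+ 2 + a * b)); last by ring.
by rewrite two_eq0 // mul0r addr0.
Qed.

Theorem theorem8 (n q : nat) (F : finFieldType) (Fq : {set F}) (a b c d : F)
    (n_gt0 : (0 < n)%N) (q_def : q = (2 ^ n)%N)
    (card_F : #|F| = (q ^ 2)%N)
    (subfield_Fq : divring_closed Fq) (card_Fq : #|Fq| = q)
    (d_notin_Fq : d \notin Fq)
    (abc : a ^+ 2 + a * b + c = 0 \/
           a ^+ 2 + a * b + c = Tr q (a + b) ^+ 2)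
    (abd : a + b + d = 0) :
  permutation_ratfun
    (('X^(q + 1) + 'X^2 + a *: 'X^q + b *: 'X + c%:P)%:F
     / ('X^q + 'X + d%:P)%:F).
Proof.
have char2 : 2%N \in [pchar F].
  by apply: (@card_finPcharP F 2 (n * 2)) => //; rewrite card_F q_def expnM.
pose sigma : {rmorphism F -> F} := pFrobenius_autn F 2 n char2.
have sigmaE x : sigma x = x ^+ q by rewrite q_def.
have sigmaK : involutive sigma.
  by move=> x; rewrite !sigmaE -exprM -[(q * q)%N]/(q ^ 2)%N -card_F expf_card.
have d_moved : sigma d != d by rewrite sigmaE -card_Fq -subfield_fixed.
have dE : a + b = d by apply/eqP; rewrite -add_eq0_char2 // abd.
have q_gt1 : (1 < q)%N by rewrite q_def -[n]prednK // expnS leq_pmulr ?expn_gt0.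
set h := 'X^q + 'X + d%:P; pose k := a ^+ 2 + a * b + c.
have hE x : h.[x] = sigma x + x + d by rewrite /h !hornerE sigmaE.
have -> : 'X^(q + 1) + 'X^2 + a *: 'X^q + b *: 'X + c%:P
    = ('X + a%:P) * h + k%:P.
  rewrite /h /k -dE !polyCD polyC_exp polyCM -!mul_polyC addn1 exprS.
  by apply: numerator_division; rewrite pchar_poly.
apply: permutation_ratfun_add_inv.
- rewrite monicE /h -addrA lead_coefDl ?lead_coefXn //.
  by rewrite size_polyXn size_XaddC.
  (* A root x of h would make d = sigma x + x a fixed element. *)
- move=> x; rewrite hE add_eq0_char2 //; apply: contraNneq d_moved => <-.
  by rewrite rmorphD /= sigmaK addrC.
case: abc => kE.
  by move=> x y; rewrite /k kE !mul0r !addr0.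
have inj := add_inv_conj_injective _ char2 _ sigmaK _ d_moved.
move=> x y; rewrite !hE /k kE /Tr dE -sigmaE; exact: inj.
Qed.
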